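(* $$\int_0^\infty \frac{1-\cos px}{\sinh qx}\,\frac{dx}{x}=\ln\cosh\frac{p\pi}{2q}.$$
   Formalization: The formula is proved for real p and real q > 0; the source states no range, and for q < 0 with p nonzero the left side is negative while the right side is positive, and for q = 0 both sides are undefined. *)

(* Defs.v *)
From mathcomp Require Import all_boot all_order all_algebra.
From mathcomp Require Import all_classical all_reals all_analysis.

Set Implicit Arguments.
Unset Strict Implicit.
Unset Printing Implicit Defensive.

Import Order.TTheory GRing.Theory Num.Theory.

Local Open Scope ring_scope.

Definition sinh (R : realType) (x : R) : R := (expR x - expR (- x)) / 2.

Definition cosh (R : realType) (x : R) : R := (expR x + expR (- x)) / 2.

(* Main.v *)
Require Import Defs.
From mathcomp Require Import all_boot all_order all_algebra.
From mathcomp Require Import all_classical all_reals all_analysis.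
From mathcomp Require Import measurable_realfun ring lra.

Import Order.TTheory GRing.Theory Num.Theory.
Import numFieldNormedType.Exports.

(** Expand 1 / sinh (q x) = 2 sum_n e^(-(2n+1) q x) and integrate termwise
    (all terms are nonnegative).  Since e^(-a x) / x is the integral of
    e^(-b x) over b >= a, Tonelli turns each term into an elementary integral
    equal to ln (1 + (p / a)^2) / 2, and the claim becomes Euler's product
    cosh (a pi / 2) = prod_n (1 + (a / (2n+1))^2).  For the latter, the
    integrals I_n(a) of cosh (a t) cos^n t over [0, pi/2] satisfy
    (n^2 + a^2) I_n(a) = n (n - 1) I_(n-2)(a), which telescopes to
    cosh (a pi / 2) = I_(2n+1)(a) / I_(2n+1)(0) * prod_(k <= n) (1 + (a / (2k+1))^2),
    and the quotient of integrals tends to 1. *)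

Local Open Scope ring_scope.
Local Open Scope classical_set_scope.

(** * Improper integrals from antiderivatives, and elementary derivatives *)

(** Two-sided differentiability on the closed half-line gives the one-sided continuity at [a]
    required by the fundamental theorem, so the integrals below need no separate argument at the
    endpoint. *)
Lemma ge0_integral_derive_itvcy {R : realType} (f F : R -> R) (a l : R) :
  (forall x, a <= x -> 0 <= f x) ->
  (forall x, a <= x -> {for x, continuous f}) ->
  (forall x, a <= x -> is_derive x 1 F (f x)) ->
  F x @[x --> +oo] --> l ->
  (\int[@lebesgue_measure R]_(x in `[a, +oo[) (f x)%:E = (l - F a)%:E)%E.
Proof.
move=> f0 cf dF Fl; rewrite EFinB; apply: ge0_continuous_FTC2y => //.
- apply: continuous_in_subspaceT => x; rewrite inE/= in_itv/= andbT.
  exact: cf.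
- by move=> x /ltW /dF [].
- apply: cvg_at_right_filter; apply: differentiable_continuous.
  by apply/derivable1_diffP; have [] := dF a (lexx a).
- by move=> x; rewrite in_itv/= andbT => /ltW /dF [_ <-]; rewrite derive1E.
Qed.

Lemma is_derive_continuous {R : realType} {f : R -> R} {x df : R} :
  is_derive x 1 f df -> {for x, continuous f}.
Proof.
by case=> df1 _; apply: differentiable_continuous; apply/derivable1_diffP.
Qed.

Lemma is_derive_expRN {R : realType} (c x : R) :
  is_derive x 1 (fun x => expR (- (c * x))) (- c * expR (- (c * x))).
Proof.
have -> : (fun x => expR (- (c * x))) = expR \o (- c \*: id).
  by apply/funext => y /=; rewrite /GRing.scale/= mulNr.
apply: is_derive_eq.
by rewrite /= /GRing.scale/= mulr1 mulNr mulrC.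
Qed.

Lemma is_derive_cosM {R : realType} (c x : R) :
  is_derive x 1 (fun x => cos (c * x)) (- c * sin (c * x)).
Proof.
have -> : (fun x => cos (c * x)) = cos \o (c \*: id).
  by apply/funext => y.
apply: is_derive_eq.
by rewrite /= /GRing.scale/= mulr1 mulNr mulrC mulNr.
Qed.

Lemma is_derive_sinM {R : realType} (c x : R) :
  is_derive x 1 (fun x => sin (c * x)) (c * cos (c * x)).
Proof.
have -> : (fun x => sin (c * x)) = sin \o (c \*: id).
  by apply/funext => y.
apply: is_derive_eq.
by rewrite /= /GRing.scale/= mulr1 mulrC.
Qed.

Lemma cvg_expRN_pinfty {R : realType} {c : R} : 0 < c ->
  expR (- (c * x)) @[x --> +oo] --> 0.
Proof.
move=> c0; apply: (cvg_comp (fun x => c * x) (fun x => expR (- x))).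
  by apply: gt0_cvgMry.
exact: cvgr_expR.
Qed.

(** * The integral of (1 - cos (p x)) e^(-a x) / x by Tonelli *)

Section frullani.
Context {R : realType}.
Notation mu := (@lebesgue_measure R).

Lemma integral_cosB1_expRN (p b : R) : 0 < b ->
  (\int[mu]_(x in `]0%R, +oo[) ((1 - cos (p * x)) * expR (- (b * x)))%:E =
   (b^-1 - b / (b ^+ 2 + p ^+ 2))%:E)%E.
Proof.
move=> b0.
have D0 : 0 < b ^+ 2 + p ^+ 2 by rewrite ltr_wpDr ?sqr_ge0 ?exprn_gt0.
pose f (x : R) : R := (1 - cos (p * x)) * expR (- (b * x)).
(* [F] is the antiderivative of [f] that vanishes at infinity: an exponential times the bounded
   trigonometric factor [G]. *)
pose G (x : R) : R := - b^-1 + (b * cos (p * x) - p * sin (p * x)) / (b ^+ 2 + p ^+ 2).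
pose F (x : R) : R := expR (- (b * x)) * G x.
have df (x : R) : is_derive x 1 f (p * sin (p * x) * expR (- (b * x))
    - b * f x).
  have h1 := is_derive_cosM p x; have h2 := is_derive_expRN b x.
  have -> : f = (cst 1 - (fun x => cos (p * x))) * (fun x => expR (- (b * x))).
    by apply/funext => y; rewrite /f !fctE.
  by apply: is_derive_eq; rewrite /f /GRing.scale/= !fctE; ring.
have dF (x : R) : is_derive x 1 F (f x).
  have h1 := is_derive_cosM p x; have h2 := is_derive_expRN b x.
  have h3 := is_derive_sinM p x.
  have -> : F = (fun x => expR (- (b * x))) *
     (cst (- b^-1) + (b ^+ 2 + p ^+ 2)^-1 \*:
       (b \*: (fun x => cos (p * x)) - p \*: (fun x => sin (p * x)))).
    by apply/funext => y; rewrite /F /G !fctE /= /GRing.scale/=; ring.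
  apply: is_derive_eq; rewrite /f /GRing.scale/= !fctE /= /GRing.scale/=.
  by field; rewrite ?gt_eqF.
(* Adding the endpoint 0 changes nothing, and [f] is differentiable there. *)
rewrite integral_itv_obnd_cbnd; last first.
  apply/measurable_EFinP; apply: measurable_funTS.
  apply: continuous_measurable_fun => x.
  exact: is_derive_continuous (df x).
rewrite (_ : b^-1 - _ = 0 - F 0); last first.
  by rewrite /F /G !mulr0 oppr0 expR0 cos0 sin0; ring.
apply: (@ge0_integral_derive_itvcy _ f F) => //.
- by move=> x _; rewrite mulr_ge0 ?expR_ge0.
- move=> x _.
  exact: is_derive_continuous (df x).
(* A uniform bound on [G], so that the exponential alone forces [F] to 0. *)
pose K := b^-1 + (b + `|p|) / (b ^+ 2 + p ^+ 2).
have GK x : `|G x| <= K.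
  rewrite /G (le_trans (ler_normD _ _))// /K normrN gtr0_norm ?invr_gt0//.
  rewrite lerD2l normrM [X in _ * X]gtr0_norm ?invr_gt0//.
  rewrite ler_pM2r ?invr_gt0// (le_trans (ler_normB _ _))// !normrM.
  rewrite (gtr0_norm b0) lerD//.
    by rewrite ler_piMr ?(ltW b0)// ler_norml cos_geN1 cos_le1.
  by rewrite ler_piMr// ler_norml sin_geN1 sin_le1.
apply/cvgr0Pnorm_le => e e0.
have K0 : 0 < K + 1.
  by rewrite ltr_wpDl// (le_trans _ (GK 0)).
have /cvgr0_norm_le /(_ (e / (K + 1))) := cvg_expRN_pinfty b0.
rewrite divr_gt0// => /(_ isT); apply: filterS => x.
rewrite /F normrM => h.
rewrite -(divfK (lt0r_neq0 K0) e) ler_pM// (le_trans (GK x))//.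
by rewrite lerDl.
Qed.

Lemma integral_expRN_itvcy (c a x : R) : 0 <= c -> 0 < x ->
  (\int[mu]_(b in `[a, +oo[) (c * expR (- (b * x)))%:E =
   (c * expR (- (a * x)) / x)%:E)%E.
Proof.
move=> c0 x0.
pose F (b : R) : R := - (c / x) * expR (- (x * b)).
have dF (b : R) : is_derive b 1 F (c * expR (- (b * x))).
  have h := is_derive_expRN x b.
  have -> : F = - (c / x) \*: (fun b => expR (- (x * b))) by [].
  apply: is_derive_eq; rewrite /GRing.scale/= [b * x]mulrC.
  by field; rewrite gt_eqF.
rewrite (_ : _ / x = 0 - F a); last by rewrite /F [a * x]mulrC; ring.
apply: ge0_integral_derive_itvcy => //.
- by move=> b _; rewrite mulr_ge0 ?expR_ge0.
- move=> b _; have h := is_derive_expRN x b.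
  rewrite (_ : (fun _ => _) = c \*: (fun b => expR (- (x * b)))).
    exact: is_derive_continuous.
  by apply/funext => y; rewrite [y * x]mulrC.
rewrite /F -[X in _ --> X](mulr0 (- (c / x))); apply: cvgM; first exact: cvg_cst.
exact: cvg_expRN_pinfty.
Qed.

Lemma integral_ln1D_sqr (p a : R) : 0 < a ->
  (\int[mu]_(b in `[a, +oo[) (b^-1 - b / (b ^+ 2 + p ^+ 2))%:E =
   (ln (1 + (p / a) ^+ 2) / 2)%:E)%E.
Proof.
move=> a0.
(* The antiderivative ln b - ln (b^2 + p^2) / 2 in a form whose limit at infinity is visibly 0. *)
pose F (b : R) : R := - ln (1 + (p / b) ^+ 2) / 2.
rewrite (_ : _ / 2 = 0 - F a); last by rewrite /F; ring.
have D0 b : 0 < b -> 0 < b ^+ 2 + p ^+ 2.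
  by move=> b0; rewrite ltr_wpDr ?sqr_ge0 ?exprn_gt0.
apply: ge0_integral_derive_itvcy.
- move=> b /(lt_le_trans a0) b0; rewrite subr_ge0 ler_pdivrMr ?D0//.
  by rewrite mulrDr expr2 mulKf ?gt_eqF// lerDl mulr_ge0 ?sqr_ge0 ?invr_ge0 ?ltW.
- move=> b /(lt_le_trans a0) b0; apply: cvgB; first by apply: cvgV => //; rewrite gt_eqF.
  apply: cvgM => //; apply: cvgV; rewrite ?gt_eqF ?D0//.
  by apply: cvgD; [exact: exprn_continuous|exact: cvg_cst].
- move=> b /(lt_le_trans a0) b0.
  have b00 : b != 0 by rewrite gt_eqF.
  have h : is_derive b 1 (fun b : R => b^-1) (- b ^- 2).
    by apply: is_derive_eq; [exact: is_deriveV| rewrite /GRing.scale/= mulr1].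
  have h1 : is_derive b 1 (cst 1 + (p \*: (fun b : R => b^-1)) ^+ 2)
     (- p ^+ 2 / b ^+ 3 * 2).
    apply: is_derive_eq; rewrite /GRing.scale/= ?fctE /= /GRing.scale/=.
    by field.
  have P0 : 0 < (cst 1 + (p \*: (fun b : R => b^-1)) ^+ 2) b.
    by rewrite !fctE /= ltr_wpDr// sqr_ge0.
  have h2 := is_derive1_ln P0.
  have -> : F = (- 2^-1) \*: (@ln R \o (cst 1 + (p \*: (fun b : R => b^-1)) ^+ 2)).
    by apply/funext => y; rewrite /F /= !fctE /= /GRing.scale/=; ring.
  apply: is_derive_eq; rewrite !fctE /= /GRing.scale/=.
  field; rewrite b00/=; have := D0 _ b0; nra.
rewrite /F.
(* The limit is written as the value at p / b = p * 0, so that continuity of [ln] at 1 concludes. *)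
rewrite -[X in _ --> X](_ : - ln (1 + (p * 0) ^+ 2) / 2 = 0); last first.
  by rewrite mulr0 expr0n addr0 ln1 oppr0 mul0r.
apply: cvgM; last exact: cvg_cst; apply: cvgN.
apply: (@cvg_comp _ _ _ (fun b => 1 + (p / b) ^+ 2) (@ln R)); last first.
  by apply: continuous_ln; rewrite mulr0 expr0n addr0.
apply: cvgD; first exact: cvg_cst.
apply: (@cvg_comp _ _ _ (fun b => p / b) (fun b => b ^+ 2)); last exact: exprn_continuous.
apply: cvgM; first exact: cvg_cst; apply/gtr0_cvgV0; first exact: nbhs_pinfty_gt.
exact: cvg_id.
Qed.

Lemma integral_cosB1_expRN_div (p a : R) : 0 < a ->
  (\int[mu]_(x in `]0%R, +oo[) ((1 - cos (p * x)) * expR (- (a * x)) / x)%:E =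
   (ln (1 + (p / a) ^+ 2) / 2)%:E)%E.
Proof.
move=> a0.
pose X : set R := `]0%R, +oo[; pose B : set R := `[a, +oo[.
pose g (z : R * R) : R := (1 - cos (p * z.1)) * expR (- (z.2 * z.1)).
(* The indicators move both half-lines into the integrand, so Tonelli applies on the whole plane.
   The factor 1 / x is absent from [g]: integrating over the second variable produces it. *)
pose h z : \bar R := ((g z) * (\1_X z.1 * \1_B z.2))%:E.
have g0 z : 0 <= g z by rewrite mulr_ge0 ?expR_ge0// subr_ge0 cos_le1.
have mh : measurable_fun setT h.
  apply/measurable_EFinP; apply: measurable_funM.
    apply: measurable_funM.
      apply: measurable_funB => //.
      apply: (measurableT_comp (f := @cos R)).
        exact: continuous_measurable_fun (@continuous_cos R).
      by apply: measurable_funM.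
    apply: (measurableT_comp (f := @expR R)) => //.
    by apply: measurable_funN; apply: measurable_funM.
  apply: measurable_funM; apply: measurableT_comp => //.
    by apply: measurable_indic; exact: measurable_itv.
  by apply: measurable_indic; exact: measurable_itv.
have h0 z : (0 <= h z)%E by rewrite lee_fin mulr_ge0// mulr_ge0// indic_ge0.
rewrite -(integral_ln1D_sqr p a a0) integral_mkcond [RHS]integral_mkcond.
transitivity (\int[mu]_x \int[mu]_y h (x, y))%E.
  apply: eq_integral => x _; rewrite patchE.
  case: ifPn => xX.
    rewrite -integral_expRN_itvcy ?subr_ge0 ?cos_le1//; last first.
      by move: xX; rewrite inE/= in_itv/= andbT.
    rewrite integral_mkcond; apply: eq_integral => y _.
    by rewrite patchE /h /g/= !indicE xX; case: ifPn; rewrite ?mulr1 ?mulr0.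
  rewrite integral0_eq// => y _.
  by rewrite /h/= indicE (negbTE xX) mul0r mulr0.
rewrite fubini_tonelli//.
apply: eq_integral => y _; rewrite patchE.
case: ifPn => yB.
  rewrite -integral_cosB1_expRN; last first.
    by move: yB; rewrite inE/= in_itv/= andbT; exact: lt_le_trans.
  rewrite [RHS]integral_mkcond; apply: eq_integral => x _.
  by rewrite patchE /h /g/= !indicE yB; case: ifPn; rewrite ?mulr1 ?mulr0.
rewrite integral0_eq// => x _.
by rewrite /h/= !indicE (negbTE yB) !mulr0.
Qed.

End frullani.

(** * Euler's product for cosh: elementary bounds and derivatives *)

Section cosh_product.
Context {R : realType}.
Notation mu := (@lebesgue_measure R).

Lemma cosh0 : cosh 0 = 1 :> R.
Proof. by rewrite /cosh oppr0 expR0; field. Qed.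

Lemma cosh_norm (x : R) : cosh `|x| = cosh x.
Proof. by case: (ler0P x) => // _; rewrite /cosh opprK addrC. Qed.

Lemma cosh_ge1 (x : R) : 1 <= cosh x.
Proof.
rewrite /cosh expRN -subr_ge0.
have e0 := expR_gt0 x.
have -> : (expR x + (expR x)^-1) / 2 - 1 = (expR x - 1) ^+ 2 / (2 * expR x).
  by field; rewrite gt_eqF.
by rewrite divr_ge0 ?sqr_ge0// mulr_ge0// ltW.
Qed.

(** By evenness take x = 2 v with v >= 0. Then cosh x - 1 = (e^v - e^(-v))^2 / 2, and e^v - e^(-v) =
    e^v (1 - e^(-2 v)) <= 2 v e^v. *)
Lemma cosh_le1D (x : R) : cosh x <= 1 + expR `|x| * x ^+ 2 / 2.
Proof.
rewrite -(cosh_norm x) -(real_normK (num_real x)).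
move: `|x| (normr_ge0 x) => {}x x0.
rewrite /cosh -lerBlDl.
pose v := x / 2.
have -> : x = v + v by rewrite /v; field.
have v0 : 0 <= v by rewrite /v divr_ge0.
rewrite opprD !expRD expRN.
have e0 := expR_gt0 v.
have h : expR v - (expR v)^-1 <= expR v * (v + v).
  have := expR_ge1Dx (- (v + v)); rewrite opprD expRD expRN => h.
  have -> : expR v - (expR v)^-1 = expR v * (1 - (expR v)^-1 * (expR v)^-1).
    by field; rewrite gt_eqF.
  by rewrite ler_pM2l//; lra.
have h0 : 0 <= expR v - (expR v)^-1.
  rewrite subr_ge0 -expRN ler_expR; lra.
have : (expR v - (expR v)^-1) ^+ 2 <= (expR v * (v + v)) ^+ 2.
  by rewrite ler_pXn2r// nnegrE// mulr_ge0// ?addr_ge0// ltW.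
have -> : (expR v - (expR v)^-1) ^+ 2 =
   expR v * expR v + (expR v)^-1 * (expR v)^-1 - 2.
  by field; rewrite gt_eqF.
lra.
Qed.

Lemma is_derive_cosh (x : R) : is_derive x 1 (@cosh R) (sinh x).
Proof.
have -> : @cosh R = 2^-1 \*: (expR + (expR \o -%R)).
  by apply/funext => y; rewrite /cosh !fctE /= /GRing.scale/=; ring.
by apply: is_derive_eq; rewrite /= /GRing.scale/= /sinh; ring.
Qed.

Lemma is_derive_sinh (x : R) : is_derive x 1 (@sinh R) (cosh x).
Proof.
have -> : @sinh R = 2^-1 \*: (expR - (expR \o -%R)).
  by apply/funext => y; rewrite /sinh !fctE /= /GRing.scale/=; ring.
by apply: is_derive_eq; rewrite /= /GRing.scale/= /cosh; ring.
Qed.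

(** The difference sin x - x cos x vanishes at 0 and has derivative x sin x, nonnegative on the
    interval. *)
Lemma mul_cos_le_sin (t : R) : 0 <= t <= pi / 2 -> t * cos t <= sin t.
Proof.
move=> /andP[t0 tpi].
pose g : R -> R := @sin R - id * @cos R.
have dg (x : R) : is_derive x 1 g (x * sin x).
  by apply: is_derive_eq; rewrite /= /GRing.scale/=; ring.
suff : g 0 <= g t by rewrite /g !fctE sin0 mul0r subr0 subr_ge0.
apply: (@ger0_derive1_ndecr _ g 0 (pi / 2)) => //.
- move=> x; rewrite in_itv/= => /andP[x0 xpi].
  rewrite derive1E; case: (dg x) => _ ->; rewrite mulr_ge0 ?ltW//.
  by rewrite sin_gt0_pi// x0/= (lt_trans xpi)// ltr_pdivrMr// ltr_pMr ?pi_gt0// ltr1n.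
- by apply: continuous_subspaceT => x; exact: is_derive_continuous (dg x).
Qed.

(** * The integrals I_n(a): recurrence and bounds *)

Definition cosh_cos (a : R) (n : nat) (t : R) : R := cosh (a * t) * cos t ^+ n.

(** This is I_n(a), taken in [R] rather than in the extended reals so that the recurrences can be
    multiplied and divided freely. *)
Definition int_cosh_cos (a : R) (n : nat) : R :=
  (\int[mu]_(t in `[0, pi / 2]) cosh_cos a n t)%R.

Lemma continuous_cosh_cos a n : continuous (cosh_cos a n).
Proof.
move=> t; apply: cvgM; last first.
  apply: (@continuous_comp _ _ _ (@cos R) (fun x => x ^+ n)).
    exact: continuous_cos.
  exact: exprn_continuous.
apply: (@continuous_comp _ _ _ ( *%R a) (@cosh R)); first exact: mulrl_continuous.
exact: is_derive_continuous (is_derive_cosh _).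
Qed.

Lemma integrable_cosh_cos a n :
  mu.-integrable `[0, pi / 2] (EFin \o cosh_cos a n).
Proof.
apply: continuous_compact_integrable; first exact: segment_compact.
by apply: continuous_subspaceT; exact: continuous_cosh_cos.
Qed.

Lemma integrableZ_cosh_cos (c a : R) n :
  mu.-integrable `[0, pi / 2] (EFin \o (fun t => c * cosh_cos a n t)).
Proof.
have -> : (EFin \o (fun t => c * cosh_cos a n t)) =
          (fun t => c%:E * (EFin \o cosh_cos a n) t)%E by apply/funext => t.
by apply: integrableZl => //; exact: integrable_cosh_cos.
Qed.

(* Two integrations by parts.  The index shifted by one covers both the
   recurrence (n > 0) and the base case I_1 (n = 0, where the term in [n.-1]
   has coefficient 0). *)
Lemma int_cosh_cos_rec a n :
  (n.+1%:R ^+ 2 + a ^+ 2) * int_cosh_cos a n.+1 =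
  n.+1%:R * n%:R * int_cosh_cos a n.-1 + (n == 0)%:R * cosh (a * (pi / 2)).
Proof.
(* [F] collects the boundary terms of both integrations by parts: in its derivative the sinh terms
   cancel and sin^2 = 1 - cos^2 leaves [f]. *)
pose F t := n.+1%:R * cosh (a * t) * cos t ^+ n * sin t +
            a * sinh (a * t) * cos t ^+ n.+1.
pose f t := (n.+1%:R ^+ 2 + a ^+ 2) * cosh_cos a n.+1 t -
            n.+1%:R * n%:R * cosh_cos a n.-1 t.
have dF (t : R) : is_derive t 1 F (f t).
  have h1 := is_derive_cosh (a * t); have h2 := is_derive_sinh (a * t).
  have -> : F = n.+1%:R \*: ((@cosh R \o (a \*: id)) * (@cos R ^+ n) * @sin R) +
     a \*: ((@sinh R \o (a \*: id)) * (@cos R ^+ n.+1)).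
    by apply/funext => y; rewrite /F !fctE /= /GRing.scale/=; ring.
  have h3 : is_derive t 1 (@cosh R \o (a \*: id)) (a * sinh (a * t)).
    by apply: is_derive_eq; rewrite /= /GRing.scale/= mulr1 mulrC.
  have h4 : is_derive t 1 (@sinh R \o (a \*: id)) (a * cosh (a * t)).
    by apply: is_derive_eq; rewrite /= /GRing.scale/= mulr1 mulrC.
  apply: is_derive_eq; rewrite !fctE /= /GRing.scale/= /f /cosh_cos.
  have e : sin t ^+ 2 = 1 - cos t ^+ 2.
    by rewrite -[in RHS](cos2Dsin2 t) addrC addKr.
  by case: n {F f} => [|n]/=; [ring: e|rewrite !exprS; ring: e].
have pi20 : 0 < pi / 2 :> R by rewrite divr_gt0 ?pi_gt0.
have If : (\int[mu]_(t in `[0%R, (pi / 2)%R]) (f t)%:E = (F (pi / 2) - F 0)%:E)%E.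
  rewrite EFinB; apply: continuous_FTC2 => //.
  - by apply: continuous_subspaceT => t; apply: cvgB; apply: cvgM; 
      (exact: cvg_cst || exact: continuous_cosh_cos).
  - split.
    + by move=> t _; case: (dF t).
    + by apply: cvg_at_right_filter; exact: is_derive_continuous (dF 0).
    + by apply: cvg_at_left_filter; exact: is_derive_continuous (dF (pi / 2)).
  - by move=> t _; rewrite derive1E; case: (dF t).
(* [F] vanishes at 0, and at pi / 2 only the term with cos^n = 0^n can survive, which requires n =
   0. *)
have Fpi : F (pi / 2) - F 0 = (n == 0)%:R * cosh (a * (pi / 2)).
  rewrite /F cos_pihalf sin_pihalf sin0 !mulr0 /sinh oppr0 subrr expr0n/=.
  by case: n {f F dF If} => [|n]; rewrite /= ?expr0 ?exprS; ring.
rewrite [RHS]addrC; apply/eqP; rewrite -subr_eq -Fpi; apply/eqP.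
rewrite /int_cosh_cos -!RintegralZl//; try exact: integrable_cosh_cos.
rewrite -RintegralB//; try exact: integrableZ_cosh_cos.
by rewrite /Rintegral If.
Qed.

(** The recurrence at a = 0, with one factor n + 2 cancelled. *)
Lemma int_cosh_cos0_rec n : n.+2%:R * int_cosh_cos 0 n.+2 = n.+1%:R * int_cosh_cos 0 n.
Proof.
have := int_cosh_cos_rec 0 n.+1.
rewrite expr0n/= addr0 mul0r addr0 expr2 -!mulrA.
by apply: mulfI; rewrite pnatr_eq0.
Qed.

Lemma int_cosh_cos1 a : (1 + a ^+ 2) * int_cosh_cos a 1 = cosh (a * (pi / 2)).
Proof. by have := int_cosh_cos_rec a 0; rewrite /= mulr0 mul0r add0r mul1r expr1n. Qed.

(** Induction from I_1(0) = 1 along a recurrence with positive coefficients. Positivity allows the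
    later division by these integrals. *)
Lemma int_cosh_cos0_odd_gt0 n : 0 < int_cosh_cos 0 n.*2.+1.
Proof.
elim: n => [|n IH].
  by have := int_cosh_cos1 0; rewrite mul0r cosh0 expr0n addr0 mul1r => ->.
have h := int_cosh_cos0_rec n.*2.+1.
by rewrite -(pmulr_rgt0 _ (ltr0Sn R n.*2.+2)) doubleS h pmulr_rgt0.
Qed.

Lemma int_cosh_cos_ge a n : (forall t, 0 <= t <= pi / 2 -> 0 <= @cos R t ^+ n) ->
  int_cosh_cos 0 n <= int_cosh_cos a n.
Proof.
move=> c0; apply: le_Rintegral => //; try exact: integrable_cosh_cos.
move=> t /=; rewrite in_itv/= => /c0 ct.
by rewrite /cosh_cos mul0r cosh0 ler_wpM2r// cosh_ge1.
Qed.

Lemma cos_ge0_0pihalf (t : R) : 0 <= t <= pi / 2 -> 0 <= cos t.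
Proof.
move=> /andP[t0 tp]; apply: cos_ge0_pihalf; rewrite tp andbT (le_trans _ t0)//.
by rewrite oppr_le0 divr_ge0// pi_ge0.
Qed.

(* From cosh (a t) <= 1 + K t^2 and t cos t <= sin t:
   t^2 cos^(n+2) t <= sin^2 t cos^n t = cos^n t - cos^(n+2) t. *)
Lemma int_cosh_cos_le a n (K := a ^+ 2 * expR (`|a| * (pi / 2)) / 2) :
  int_cosh_cos a n.+2 <= (1 - K) * int_cosh_cos 0 n.+2 + K * int_cosh_cos 0 n.
Proof.
rewrite /int_cosh_cos -!RintegralZl//; try exact: integrable_cosh_cos.
rewrite -RintegralD//; try exact: integrableZ_cosh_cos.
apply: le_Rintegral => //.
- exact: integrable_cosh_cos.
- have -> : EFin \o (fun x => (1 - K) * cosh_cos 0 n.+2 x + K * cosh_cos 0 n x) =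
    (EFin \o (fun x => (1 - K) * cosh_cos 0 n.+2 x)) \+
    (EFin \o (fun x => K * cosh_cos 0 n x)) by apply/funext => t.
  by apply: integrableD => //; exact: integrableZ_cosh_cos.
move=> t /=; rewrite in_itv/= => tP.
have /andP[t0 tp] := tP.
have K0 : 0 <= K by rewrite divr_ge0// mulr_ge0 ?sqr_ge0 ?expR_ge0.
have c0 := cos_ge0_0pihalf _ tP.
rewrite /cosh_cos mul0r cosh0 !mul1r 2!exprS.
have cn0 : 0 <= cos t ^+ n by rewrite exprn_ge0.
have h1 : cosh (a * t) <= 1 + K * t ^+ 2.
  rewrite (le_trans (cosh_le1D _))// lerD2l /K normrM (ger0_norm t0) exprMn.
  have : expR (`|a| * t) <= expR (`|a| * (pi / 2)).
    by rewrite ler_expR ler_wpM2l.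
  move: (mulr_ge0 (sqr_ge0 a) (sqr_ge0 t)); move: (expR _) (expR _) => u v at0 uv.
  rewrite -subr_ge0 in uv.
  by have := mulr_ge0 at0 uv; lra.
have h2 : (t * cos t) ^+ 2 <= 1 - cos t ^+ 2.
  rewrite -[in leRHS](cos2Dsin2 t) addrC addKr ler_pXn2r// ?nnegrE.
  - exact: mul_cos_le_sin.
  - by rewrite mulr_ge0.
  - by rewrite (le_trans _ (mul_cos_le_sin _ tP))// mulr_ge0.
have h3 : cosh (a * t) * (cos t * (cos t * cos t ^+ n)) <=
    (1 + K * t ^+ 2) * (cos t * (cos t * cos t ^+ n)).
  by rewrite ler_wpM2r// !mulr_ge0.
apply: le_trans h3 _.
have := ler_wpM2l (mulr_ge0 K0 cn0) h2.
move: (cos t ^+ n) => c; lra.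
Qed.

(** * The finite product formula and its limit *)

(** Comparing the recurrences at [a] and at 0 with N = 2 n + 3 produces the new factor (N^2 + a^2) /
    N^2. The identity is cross-multiplied so that no integral stands in a denominator. *)
Lemma int_cosh_cos_prod a n :
  int_cosh_cos a n.*2.+1 * \prod_(k < n.+1) (1 + (a / k.*2.+1%:R) ^+ 2) =
  cosh (a * (pi / 2)) * int_cosh_cos 0 n.*2.+1.
Proof.
elim: n => [|n IH].
  rewrite big_ord_recl big_ord0 mulr1 divr1 mulrC int_cosh_cos1.
  by have := int_cosh_cos1 0; rewrite mul0r cosh0 expr0n addr0 mul1r => ->; rewrite mulr1.
rewrite big_ord_recr/= doubleS.
have h := int_cosh_cos_rec a n.*2.+2.
have h0 := int_cosh_cos0_rec n.*2.+1.
rewrite /= mul0r addr0 in h.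
set N : R := n.*2.+3%:R in h h0 *; set M : R := n.*2.+2%:R in h h0 *.
have N0 : N != 0 by rewrite pnatr_eq0.
have M0 : M != 0 by rewrite pnatr_eq0.
move: IH h h0.
move: (int_cosh_cos a _) (int_cosh_cos a _) (int_cosh_cos 0 _) (int_cosh_cos 0 _).
move: (\prod_(_ < _) _) (cosh _) => P C A2 A0 B2 B0 IH hA hB.
have N20 : N ^+ 2 != 0 by rewrite expf_neq0.
apply: (mulfI N20).
have -> : N ^+ 2 * (A2 * (P * (1 + (a / N) ^+ 2))) = P * ((N ^+ 2 + a ^+ 2) * A2).
  by field.
have -> : N ^+ 2 * (C * B2) = N * C * (N * B2) by ring.
rewrite hA hB.
have -> : P * (N * M * A0) = N * M * (A0 * P) by ring.
by rewrite IH; ring.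
Qed.

(** A squeeze: the partial product is cosh (a pi / 2) times B / A, where A and B are the integrals
    at [a] and at 0, and B <= A <= (1 + K / (2 (n + 1))) B. *)
Lemma cvg_prod_cosh (a : R) :
  (\prod_(k < n) (1 + (a / k.*2.+1%:R) ^+ 2) @[n --> \oo] --> cosh (a * (pi / 2)))%R.
Proof.
pose P n : R := \prod_(k < n) (1 + (a / k.*2.+1%:R) ^+ 2).
pose C := cosh (a * (pi / 2)).
pose K := a ^+ 2 * expR (`|a| * (pi / 2)) / 2.
have K0 : 0 <= K by rewrite divr_ge0// mulr_ge0 ?sqr_ge0 ?expR_ge0.
have C0 : 0 <= C by rewrite (le_trans _ (cosh_ge1 _)).
(* The shift by two fits [int_cosh_cos_le], which compares the indices 2 n + 3 and 2 n + 1. The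
   lower bound is weaker than the available one but linear in [harmonic n] = 1 / (n + 1). *)
suff h n : C * (1 - K * harmonic n) <= P n.+2 <= C.
  rewrite -/C -(@cvg_shiftn 2); under eq_fun do rewrite addn2.
  have hC : C * (1 - K * @harmonic R n) @[n --> \oo] --> C * (1 - K * 0).
    apply: cvgM; first exact: cvg_cst.
    apply: cvgB; first exact: cvg_cst.
    by apply: cvgM; [exact: cvg_cst|exact: cvg_harmonic].
  rewrite mulr0 subr0 mulr1 in hC.
  apply: squeeze_cvgr hC (cvg_cst C).
  by near=> n; exact: h.
have B0 := int_cosh_cos0_odd_gt0 n.+1.
have AB : int_cosh_cos 0 n.+1.*2.+1 <= int_cosh_cos a n.+1.*2.+1.
  by apply: int_cosh_cos_ge => t /cos_ge0_0pihalf c0; rewrite exprn_ge0.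
have := int_cosh_cos_prod a n.+1; rewrite -/(P n.+2) -/C.
have /= := int_cosh_cos_le a n.*2.+1; rewrite -/K.
have := int_cosh_cos0_rec n.*2.+1.
move: B0 AB; rewrite doubleS.
move: (int_cosh_cos a _) (int_cosh_cos 0 n.*2.+3) (int_cosh_cos 0 n.*2.+1)
  => A B B' B0 AB hB hA hP.
have A0 : 0 < A by exact: lt_le_trans AB.
have -> : P n.+2 = C * B / A by rewrite -hP mulrC mulKf ?gt_eqF.
rewrite ler_pdivrMr// ler_pdivlMr//.
apply/andP; split; last by rewrite ler_wpM2l.
rewrite -mulrA ler_wpM2l//.
have hB' : B' = (1 + harmonic n / 2) * B.
  apply: (mulfI (x := n.*2.+2%:R)); first by rewrite pnatr_eq0.
  rewrite -hB /harmonic/= -doubleS -natr1 -mul2n natrM.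
  by move: n.+1%:R (pnatr_eq0 R n.+1) => m /= /negbT m0; field.
move: hA (mulr_ge0 K0 (harmonic_ge0 n)); rewrite hB'.
have -> : (1 - K) * B + K * ((1 + harmonic n / 2) * B) = (1 + K * harmonic n / 2) * B.
  by ring.
move: (K * _) => y hA y0.
(* If 1 - y <= 0 the left side is nonpositive; otherwise (1 - y) (1 + y / 2) <= 1 for y >= 0. *)
have [y1|y1] := leP (1 - y) 0.
  by rewrite (le_trans _ (ltW B0))// mulr_le0_ge0// ltW.
apply: le_trans (ler_wpM2l (ltW y1) hA) _.
rewrite mulrA ler_piMl ?(ltW B0)//; nra.
Unshelve. all: by end_near. Qed.
End cosh_product.

(** * Logarithm of the product and termwise integration *)

(** Partial sums of logarithms are logarithms of partial products, and [ln] is continuous at the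
    limit because cosh >= 1. *)
Lemma nneseries_ln_cosh {R : realType} (a : R) :
  (\sum_(n <oo) (ln (1 + (a / n.*2.+1%:R) ^+ 2))%:E = (ln (cosh (a * (pi / 2))))%:E)%E.
Proof.
apply: cvg_lim => //.
rewrite (_ : (fun n => _) =
    EFin \o (fun n => ln (\prod_(k < n) (1 + (a / k.*2.+1%:R) ^+ 2)))).
  apply: cvg_EFin; first by near=> n.
  apply: (cvg_comp (fun n => _) (@ln R) (cvg_prod_cosh a)).
  by apply: continuous_ln; rewrite (lt_le_trans ltr01)// cosh_ge1.
apply/funext => n /=; rewrite sumEFin; congr EFin.
elim: n => [|n IH]; first by rewrite big_nil big_ord0 ln1.
have P0 (k : nat) : 0 < 1 + (a / k.*2.+1%:R) ^+ 2 by rewrite ltr_wpDr// sqr_ge0.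
rewrite big_nat_recr//= IH big_ord_recr/= lnM// posrE// prodr_gt0.
Unshelve. all: by end_near. Qed.

Theorem mainTheorem4 (R : realType) (p q : R) (q_gt0 : 0 < q) :
  (\int[@lebesgue_measure R]_(x in `]0%R, +oo[)
      ((1 - cos (p * x)) / sinh (q * x) / x)%:E
   = (ln (cosh (p * pi / (2 * q))))%:E)%E.
Proof.
pose b n := n.*2.+1%:R * q.
have b0 n : 0 < b n by rewrite mulr_gt0.
(* The 2 comes from the expansion of 1 / sinh and finally cancels the 1 / 2 in
   [integral_cosB1_expRN_div]. *)
pose f n x := (2 * ((1 - cos (p * x)) * expR (- (b n * x)) / x))%:E.
transitivity (\int[@lebesgue_measure R]_(x in `]0%R, +oo[) (\sum_(n <oo) f n x))%E.
  apply: eq_integral => x; rewrite inE/= in_itv/= andbT => x0.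
  apply/esym/cvg_lim => //.
  (* First term and ratio of the geometric series: u / (1 - z) is the integrand since e^(-q x) / (1
     - e^(-2 q x)) = 1 / (2 sinh (q x)). *)
  pose u := 2 * ((1 - cos (p * x)) * expR (- (q * x)) / x).
  pose z := expR (- (2 * (q * x))).
  have z1 : z < 1 by rewrite /z expR_lt1 oppr_lt0 !mulr_gt0.
  rewrite (_ : (fun n => _) = EFin \o series (geometric u z)).
    apply: cvg_EFin; first by near=> n.
    rewrite (_ : _ / x = u / (1 - z)).
      by apply: cvg_geometric_series; rewrite ger0_norm ?expR_ge0.
    have -> : z = expR (- (q * x)) * expR (- (q * x)).
      by rewrite -expRD /z; congr expR; ring.
    rewrite /u /sinh expRN.
    have : 1 < expR (q * x) by rewrite expR_gt1 mulr_gt0.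
    move: (expR _) => E E1.
    field; rewrite !gt_eqF//; nra.
  apply/funext => n /=; rewrite /series/= sumEFin; congr EFin.
  apply: eq_bigr => k _; rewrite /u /z -expRM_natl.
  rewrite (_ : - (b k * x) = - (q * x) + k%:R * - (2 * (q * x))); last first.
    by rewrite /b -natr1 -mul2n natrM; ring.
  by rewrite expRD; ring.
have mg n : measurable_fun (`]0%R, +oo[ : set R)
    (fun x : R => (1 - cos (p * x)) * expR (- (b n * x)) / x).
  apply: open_continuous_measurable_fun => // x.
  rewrite inE/= in_itv/= andbT => x0.
  apply: cvgM; last by apply: cvgV; [rewrite gt_eqF|].
  apply: cvgM.
    by apply: cvgB; [exact: cvg_cst|exact: is_derive_continuous (is_derive_cosM p x)].
  exact: is_derive_continuous (is_derive_expRN (b n) x).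
have g0 n (x : R) : (`]0%R, +oo[ : set R) x -> 0 <= (1 - cos (p * x)) * expR (- (b n * x)) / x.
  rewrite /= in_itv/= andbT => x0.
  by rewrite divr_ge0 ?(ltW x0)// mulr_ge0 ?expR_ge0// subr_ge0 cos_le1.
rewrite integral_nneseries//; last 2 first.
- by move=> n; apply/measurable_EFinP; apply: measurable_funM; [exact: measurable_cst|exact: mg].
- by move=> n x /(g0 n) h; rewrite lee_fin mulr_ge0.
(* Euler's product is used at a = p / q: its factors match because p / b n = (p / q) / (2 n + 1). *)
rewrite (_ : p * pi / (2 * q) = p / q * (pi / 2)); last by field; rewrite gt_eqF.
rewrite -nneseries_ln_cosh; apply: eq_eseriesr => n _.
under eq_integral do rewrite /f EFinM.
rewrite ge0_integralZl_EFin//.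
- rewrite integral_cosB1_expRN_div// -EFinM /b mulrC divfK// invfM mulrA.
  by rewrite mulrAC.
- by move=> x /(g0 n).
- by apply/measurable_EFinP; exact: mg.
Unshelve. all: by end_near. Qed.
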